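(* Let $F$ be an arbitrary field and let $A\in M_n(F)$. For a monic irreducible factor $p$ of the minimal polynomial of $A$, let $\ell(p)$ be the sum of the multiplicities of all elementary divisors of $A$ which are a power of an $\Omega$-conjugate of $p$. Suppose that, for every monic irreducible factor $p$ of the minimal polynomial of $A$: $|F^+|\ge \ell(p)$ if $S_p=\{0\}$, and $|F^*|\ge \ell(p)$ if $S_p\ne\{0\}$ but $T_p=\{1\}$. Then $A$ is of polynomial type. More precisely, let $q_1,\dots,q_m$ be the elementary divisors of $A$ (listed with multiplicity), where each $q_i=p_i^{e_i}$ is a positive power of a monic irreducible factor $p_i$ of the minimal polynomial of $A$ (the $p_1,\dots,p_m$ are not assumed distinct). Then $A$ is similar to $g(C_f)$ for some $g\in F[X]$ and $f=f_1\cdots f_m$, where each $f_i=r_i^{e_i}$ for a suitable $\Omega$-conjugate $r_i$ of $p_i$, and $r_1,\dots,r_m$ are distinct.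
   Context: For monic $f=f_0+f_1X+\cdots+f_{n-1}X^{n-1}+X^n\in F[X]$ the companion matrix $C_f\in M_n(F)$ has $1$'s on the first subdiagonal, last column $(-f_0,\dots,-f_{n-1})^T$, and $0$'s elsewhere. A matrix $A\in M_n(F)$ is of polynomial type if $A$ is similar to $g(C_f)$ for some $f,g\in F[X]$ with $f$ monic of degree $n$. The elementary divisors of $A$ are the powers $p^a$ ($p$ monic irreducible, $a\ge1$), with multiplicity, such that $A$ is similar to the direct sum of the $C_{p^a}$. $F^+$ and $F^*$ are the additive and multiplicative groups of $F$. $\Omega$ is the group of all matrices $M=\begin{pmatrix} a & b\\ 0& 1\end{pmatrix}$ with $a\in F^*$, $b\in F$. It acts on $F[X]$ by $f^M(X)=a^{-\deg f}f(aX+b)$ for $f\ne 0$ and $0^M=0$; an $\Omega$-conjugate of $f$ is any $f^M$, $M\in\Omega$. For a nonzero polynomial $p$, $S_p=\{b\in F: p(X+b)=p(X)\}$ and $T_p=\{a\in F^*: a^{-\deg p}p(aX)=p(X)\}$ are its stabilizers in $F^+$ and $F^*$. *)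

(* Defs.v *)
From mathcomp Require Import all_boot all_order all_algebra.
From mathcomp Require Import boolp classical_sets functions cardinality.

Set Implicit Arguments.
Unset Strict Implicit.
Unset Printing Implicit Defensive.

Import GRing.Theory.
Local Open Scope ring_scope.
Local Open Scope classical_set_scope.
Local Open Scope card_scope.

(* The library's [companionmx] is the transpose of the convention used here
   and has its size fixed to [(size f).-1]; the explicit size [n] lets
   [companion n.+1 f] be an argument of [horner_mx].  See [companionE]. *)
Definition companion (F : fieldType) (n : nat) (f : {poly F}) : 'M[F]_n :=
  \matrix_(i < n, j < n)
    if j == n.-1 :> nat then - f`_i else (i == j.+1 :> nat)%:R.

Lemma companionE (F : fieldType) (f : {poly F}) :
  companion (size f).-1 f = (companionmx f)^T.
Proof. by apply/matrixP => i j; rewrite !mxE [_ == j.+1 :> nat]eq_sym. Qed.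

Definition polynomial_type (F : fieldType) (n : nat) (A : 'M[F]_n.+1) : Prop :=
  exists f g : {poly F}, [/\ f \is monic, size f = n.+2
    & A ~_{in unitmx} horner_mx (companion n.+1 f) g].

(* The family [q] lists the elementary divisors of [A] with multiplicity, in
   some order. *)
Definition elementary_divisors (F : fieldType) (n : nat) (A : 'M[F]_n)
    (m : nat) (q : 'I_m -> {poly F}) : Prop :=
  (forall i, exists (p : {poly F}) (a : nat),
     [/\ p \is monic, irreducible_poly p, (0 < a)%N & q i = p ^+ a]) /\
  exists eq_n : (\sum_(i < m) (size (q i)).-1)%N = n,
    A ~_{in unitmx}
      castmx (eq_n, eq_n) (\mxdiag_(i < m) companion (size (q i)).-1 (q i)).

(* The action of the matrix with rows (a, b) and (0, 1), for [a != 0]. *)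
Definition Omega_act (F : fieldType) (a b : F) (f : {poly F}) : {poly F} :=
  a ^- (size f).-1 *: (f \Po (a *: 'X + b%:P)).

Definition Omega_conjugate (F : fieldType) (f r : {poly F}) : Prop :=
  exists a b : F, a != 0 /\ r = Omega_act a b f.

Definition add_stab (F : fieldType) (p : {poly F}) : set F :=
  [set b : F | p \Po ('X + b%:P) = p].

Definition mul_stab (F : fieldType) (p : {poly F}) : set F :=
  [set a : F | a != 0 /\ a ^- (size p).-1 *: (p \Po (a *: 'X)) = p].

Definition ell (F : fieldType) (m : nat) (q : 'I_m -> {poly F})
    (p : {poly F}) : nat :=
  #|[pred i : 'I_m | `[< exists (r : {poly F}) (k : nat),
       [/\ Omega_conjugate p r, (0 < k)%N & q i = r ^+ k] >]]|.

(* Main.v *)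
Require Import Defs.
From HB Require Import structures.
From mathcomp Require Import all_boot all_order all_algebra.
From mathcomp Require Import fingroup cyclic qfpoly.
From mathcomp Require Import boolp classical_sets functions cardinality.

Set Implicit Arguments.
Unset Strict Implicit.
Unset Printing Implicit Defensive.

Import GRing.Theory.
Local Open Scope ring_scope.

(** View the space of row vectors of length [n.+1] as an [F[X]]-module, [X]
    acting by right multiplication by [B]; with [B := A^T] this is the module
    of [A] acting on columns.  By [decomp_similar], [A] is similar to the
    direct sum of the companion matrices of the [q i] as soon as this module is
    the direct sum of cyclic modules [F[X]/(q i)] with [sum_i deg (q i)] equal
    to [n.+1]; so two matrices having such decompositions for the same family
    [q] are similar.

    Suppose that [r i] is the conjugate of [p i] by the affine substitution
    [l i := a i *: 'X + b i], and that the monic irreducible [r i] are distinct.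
    By the Chinese remainder theorem there is one [g] with
    [g = l i  mod r i ^+ e i] for all [i].  Then [r i ^+ e i] divides [h \Po g]
    iff it divides [h \Po l i], iff [p i ^+ e i] divides [h].  The module of
    [C_f], for [f := \prod_i r i ^+ e i], is cyclic with annihilator [f], hence
    the sum of the [F[X]/(r i ^+ e i)]; so the module of [g(C_f)] is the sum of
    the [F[X]/(p i ^+ e i)], and [A] is similar to [g(C_f)]
    ([decomp_companion], [similar_polynomial_companion]).

    It remains to pick distinct conjugates.  Conjugates of members of different
    classes are different, so it is enough that the orbit of [p] has at least
    [ell p] elements ([orbit_injection]).  When [S_p] (resp. [T_p]) is trivial
    the translates (resp. the rescalings) of [p] are distinct and the
    cardinality hypothesis applies.  When both are nontrivial, [F] is infinite:
    if it were finite, the substitutions [X -> X + b] and [X -> a X] would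
    induce commuting maps on [F[X]/(p)], as they act as power maps on the cyclic
    group of units, and comparing their composites at [X] gives
    [a b = b], that is, [a = 1] ([stabilizers_finite_field]).  And over an
    infinite field the translates [p(X + b)] already take infinitely many
    values, because their constant terms [p(b)] do.

    Finally, the first conclusion needs the existence of elementary divisors:
    [stable_primary_decomposition] splits off a cyclic submodule of maximal
    [p]-power order, the complement being cut out by the translates of a
    linear functional. *)

(** * Affine substitutions and conjugates *)

Section Affine.
Variable F : fieldType.
Implicit Types (a b : F) (f p q r h : {poly F}).

(** The affine polynomial [a X + b]; substituting it is the unscaled action
    of the matrix with rows [(a, b)] and [(0, 1)]. *)
Definition aff a b : {poly F} := a *: 'X + b%:P.

Lemma comp_aff a b c d : aff a b \Po aff c d = aff (a * c) (a * d + b).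
Proof.
rewrite /aff comp_polyD comp_polyC comp_polyZ comp_polyX scalerDr scalerA.
by rewrite -addrA -[a *: d%:P]mul_polyC -polyCM -polyCD.
Qed.

Lemma aff10 : aff 1 0 = 'X.
Proof. by rewrite /aff scale1r addr0. Qed.

Lemma comp_affK a b h : a != 0 -> (h \Po aff a b) \Po aff a^-1 (- (b / a)) = h.
Proof.
move=> a0; rewrite -comp_polyA comp_aff divff// mulrN mulrC divfK//.
by rewrite addNr aff10 comp_polyXr.
Qed.

Lemma comp_affVK a b h : a != 0 -> (h \Po aff a^-1 (- (b / a))) \Po aff a b = h.
Proof.
move=> a0; rewrite -comp_polyA comp_aff mulVf// [a^-1 * b]mulrC subrr.
by rewrite aff10 comp_polyXr.
Qed.

Lemma dvdp_comp_aff a b p h :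
  a != 0 -> (p \Po aff a b %| h \Po aff a b) = (p %| h).
Proof.
move=> a0; apply/idP/idP => [|]; last exact: dvdp_comp_poly.
by move/(dvdp_comp_poly (aff a^-1 (- (b / a)))); rewrite !comp_affK.
Qed.

Lemma size_aff a b : a != 0 -> size (aff a b) = 2.
Proof.
move=> a0; rewrite /aff -mul_polyC size_MXaddC polyC_eq0 (negPf a0).
by rewrite size_polyC a0.
Qed.

Lemma lead_coef_aff a b : a != 0 -> lead_coef (aff a b) = a.
Proof.
by move=> a0; rewrite lead_coefE size_aff// /aff coefD coefZ coefX coefC mulr1
  addr0.
Qed.

Lemma size_comp_aff a b h : a != 0 -> size (h \Po aff a b) = size h.
Proof. by move=> a0; rewrite size_comp_poly2// size_aff. Qed.

Lemma Omega_actE a b f : Omega_act a b f = a ^- (size f).-1 *: (f \Po aff a b).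
Proof. by []. Qed.

Lemma size_Omega_act a b f : a != 0 -> size (Omega_act a b f) = size f.
Proof.
by move=> a0; rewrite Omega_actE size_scale ?invr_eq0 ?expf_neq0//
  size_comp_aff.
Qed.

Lemma monic_Omega_act a b f : a != 0 -> f \is monic ->
  Omega_act a b f \is monic.
Proof.
move=> a0 /monicP fm; apply/monicP; rewrite Omega_actE lead_coefZ.
rewrite lead_coef_comp ?size_aff// fm mul1r lead_coef_aff//.
by rewrite mulVf// expf_neq0.
Qed.

(** Divisibility by a conjugate of [f] is, up to the substitution,
    divisibility by [f]; this is what turns [F[X]/(r)] into [F[X]/(p)] when
    [r] is a conjugate of [p]. *)
Lemma dvdp_Omega_act a b f h :
  a != 0 -> (Omega_act a b f %| h \Po aff a b) = (f %| h).
Proof.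
move=> a0; rewrite Omega_actE dvdpZl ?dvdp_comp_aff//.
by rewrite invr_eq0 expf_neq0.
Qed.

Lemma Omega_actX a b f k : Omega_act a b (f ^+ k) = Omega_act a b f ^+ k.
Proof.
rewrite !Omega_actE exprZn; congr (_ *: _); last first.
  by elim: k => [|k IH]; rewrite ?expr0 ?comp_polyC// !exprS comp_polyM IH.
have [->|f0] := eqVneq f 0.
  rewrite size_poly0 expr0 invr1 expr1n; case: k => [|k].
    by rewrite expr0 size_poly1 expr0 invr1.
  by rewrite expr0n size_poly0 expr0 invr1.
by rewrite size_exp exprVn exprM.
Qed.

Lemma irreducible_Omega_act a b f :
  a != 0 -> irreducible_poly f -> irreducible_poly (Omega_act a b f).
Proof.
move=> a0 irf; split; first by rewrite size_Omega_act// irf.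
move=> q q1 qr; set l' := aff a^-1 (- (b / a)).
have qE : q = (q \Po l') \Po aff a b by rewrite comp_affVK.
have c0 : a ^- (size f).-1 != 0 by rewrite invr_eq0 expf_neq0.
have e1 : q \Po l' %= f.
  apply: irf; first by rewrite size_comp_aff ?invr_eq0.
  by move: qr; rewrite {1}qE Omega_actE dvdpZr// dvdp_comp_aff.
rewrite qE; apply/andP; rewrite !Omega_actE dvdpZl// dvdpZr// !dvdp_comp_aff//.
exact/andP.
Qed.

Lemma Omega_act_comp a b c d f : a != 0 ->
  Omega_act c d (Omega_act a b f) = Omega_act (a * c) (a * d + b) f.
Proof.
move=> a0; rewrite [LHS]Omega_actE size_Omega_act// !Omega_actE comp_polyZ.
by rewrite scalerA -comp_polyA comp_aff exprMn invfM mulrC.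
Qed.

Lemma Omega_act10 f : Omega_act 1 0 f = f.
Proof. by rewrite Omega_actE expr1n invr1 scale1r aff10 comp_polyXr. Qed.

Lemma Omega_conj_refl f : Omega_conjugate f f.
Proof. by exists 1, 0; rewrite oner_eq0 Omega_act10. Qed.

Lemma Omega_conj_sym f r : Omega_conjugate f r -> Omega_conjugate r f.
Proof.
move=> [a [b [a0 ->]]]; exists a^-1, (- (b / a)); rewrite invr_eq0; split=> //.
by rewrite Omega_act_comp// divff// mulrN mulrC divfK// addNr Omega_act10.
Qed.

Lemma Omega_conj_trans f r h :
  Omega_conjugate f r -> Omega_conjugate r h -> Omega_conjugate f h.
Proof.
move=> [a [b [a0 ->]]] [c [d [c0 ->]]]; exists (a * c), (a * d + b).
by rewrite Omega_act_comp// mulf_neq0.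
Qed.

End Affine.

(** * Cyclic decompositions and similarity *)

Section Krylov.
Variables (F : fieldType).

Lemma horner_mx_tr n (A : 'M[F]_n.+1) h : (horner_mx A h)^T = horner_mx A^T h.
Proof.
elim/poly_ind: h => [|h c IH]; first by rewrite !rmorph0 trmx0.
rewrite !rmorphD !rmorphM /= !horner_mx_X !horner_mx_C linearD /= tr_scalar_mx.
rewrite -[(_ * A)^T]/((_ *m A)^T) trmx_mul IH; congr (_ + _).
by apply: comm_mx_horner.
Qed.

Lemma act_hornerM n (B : 'M[F]_n.+1) (v : 'rV_n.+1) h k :
  v *m horner_mx B (h * k) = v *m horner_mx B h *m horner_mx B k.
Proof. by rewrite rmorphM /= -mulmxA. Qed.

Lemma act_dvdp n (B : 'M[F]_n.+1) (v : 'rV_n.+1) h k :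
  h %| k -> v *m horner_mx B h = 0 -> v *m horner_mx B k = 0.
Proof. by move=> /dvdpP[c ->] vh; rewrite mulrC act_hornerM vh mul0mx. Qed.

Lemma act_coprime n (B : 'M[F]_n.+1) (v : 'rV_n.+1) h k :
  coprimep h k -> v *m horner_mx B h = 0 -> v *m horner_mx B k = 0 -> v = 0.
Proof.
move=> /Bezout_eq1_coprimepP[[c d] /= cd] vh vk.
rewrite (_ : v = v *m horner_mx B 1); last by rewrite rmorph1 mulmx1.
rewrite -cd rmorphD /= mulmxDr.
rewrite (act_dvdp (dvdp_mull _ (dvdpp h)))//.
by rewrite (act_dvdp (dvdp_mull _ (dvdpp k)))// addr0.
Qed.

(** The matrix with rows [v, v B, ..., v B^(d-1)]. *)
Definition krylov n (B : 'M[F]_n.+1) d (v : 'rV[F]_n.+1) : 'M[F]_(d, n.+1) :=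
  \matrix_(j < d) (v *m horner_mx B 'X^j).

(** Linear combinations of the rows of a Krylov matrix are the values at [v]
    of the polynomials in [B] of degree less than [d]. *)
Lemma mul_krylov n (B : 'M[F]_n.+1) d (v : 'rV_n.+1) (y : 'rV_d) :
  y *m krylov B d v = v *m horner_mx B (rVpoly y).
Proof.
rewrite mulmx_sum_row /rVpoly poly_def linear_sum /= mulmx_sumr.
apply: eq_bigr => j _; rewrite rowK linearZ /= -scalemxAr.
by case: insubP => [k _ /val_inj ->//|]; rewrite ltn_ord.
Qed.

(** On the Krylov rows of a vector killed by [q], the matrix [B] acts as the
    transposed companion matrix of [q]. *)
Lemma krylov_companion n (B : 'M[F]_n.+1) (q : {poly F}) v :
  q \is monic -> v *m horner_mx B q = 0 ->
  krylov B (size q).-1 v *m B =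
    (companion (size q).-1 q)^T *m krylov B (size q).-1 v.
Proof.
move=> qm vq; apply/row_matrixP => j; rewrite row_mul rowK row_mul mul_krylov.
rewrite -{2}(horner_mx_X B) -act_hornerM -exprSr.
have [jd|jd] := eqVneq (j : nat) (size q).-1.-1.
- (* The last row: [v B^d] is rewritten by means of [v q(B) = 0]. *)
  have dE : j.+1 = (size q).-1 by rewrite jd prednK// (leq_ltn_trans (leq0n j)).
  rewrite dE; apply/eqP; rewrite -subr_eq0 -mulmxBr -rmorphB /= -{}vq;
    apply/eqP.
  congr (v *m horner_mx B _); apply/polyP => i;
    rewrite coefB coefXn coef_rVpoly.
  case: insubP => [k ik kE|ik].
    by rewrite !mxE jd eqxx -kE opprK ltn_eqF ?ltn_ord// add0r.
  rewrite subr0; have := ik; rewrite -leqNgt leq_eqVlt => /predU1P[<-|ik'].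
    by rewrite eqxx; move/monicP: qm; rewrite lead_coefE => ->.
  by rewrite gtn_eqF// nth_default// (leq_trans (leqSpred _) ik').
- congr (v *m horner_mx B _); apply/polyP => i; rewrite coefXn coef_rVpoly.
  case: insubP => [k ik kE|ik]; first by rewrite !mxE (negPf jd) -kE.
  rewrite (_ : (i == j.+1) = false)//; apply/negP => /eqP iE.
  have jlt := ltn_ord j; case/negP: ik; rewrite iE.
  have aux d j' : (j' < d -> j' != d.-1 -> j'.+1 < d)%N.
    by case: d => // d /=; rewrite !ltnS ltn_neqAle => -> ->.
  exact: aux.
Qed.

(** The submodule generated by the [u i] is the direct sum of the cyclic
    modules [F[X] (u i)], and [u i] has annihilator generated by [q i].  That
    the [u i] generate the whole space is not part of the definition: it
    follows when the degrees of the [q i] add up to the dimension. *)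
Definition decomp n (B : 'M[F]_n.+1) m (q : 'I_m -> {poly F})
    (u : 'I_m -> 'rV[F]_n.+1) : Prop :=
  forall h : 'I_m -> {poly F},
    \sum_i u i *m horner_mx B (h i) = 0 <-> forall i, q i %| h i.

Lemma decomp_act0 n (B : 'M[F]_n.+1) m (q : 'I_m -> {poly F}) u h i :
  decomp B q u -> (q i %| h) <-> u i *m horner_mx B h = 0.
Proof.
move=> /(_ (fun j => if j == i then h else 0)) H; split=> [qh|uh].
  have [_ /(_ _)] := H; rewrite (bigD1 i)//= eqxx big1 ?addr0 => [|j /negPf->].
    by apply=> j; case: eqVneq => [->|]; rewrite ?dvdp0.
  by rewrite rmorph0 mulmx0.
have [+ _] := H => /(_ _ i); rewrite eqxx; apply.
rewrite (bigD1 i)//= eqxx uh add0r big1// => j /negPf->.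
by rewrite rmorph0 mulmx0.
Qed.

Lemma castmx_mulr a b N (eq_ab : a = b) (D : 'M[F]_a) (Q : 'M_(a, N)) :
  castmx (eq_ab, eq_ab) D *m castmx (eq_ab, erefl N) Q =
    castmx (eq_ab, erefl N) (D *m Q).
Proof. by case: _ / eq_ab; rewrite !castmx_id. Qed.

Lemma castmx_mull a b N (eq_ab : a = b) M (D : 'M[F]_(N, M)) (Q : 'M_(a, N)) :
  castmx (eq_ab, erefl N) Q *m D = castmx (eq_ab, erefl M) (Q *m D).
Proof. by case: _ / eq_ab; rewrite !castmx_id. Qed.

Lemma row_free_castmx a b N (eq_ab : a = b) (Q : 'M[F]_(a, N)) :
  row_free (castmx (eq_ab, erefl N) Q) = row_free Q.
Proof. by case: _ / eq_ab; rewrite castmx_id. Qed.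

(** The Krylov rows of the [u i] form a basis, by a count of degrees, and in
    this basis the action of [A^T] is block diagonal. *)
Lemma decomp_similar n (A : 'M[F]_n.+1) m (q : 'I_m -> {poly F}) u
    (eq_n : (\sum_(i < m) (size (q i)).-1)%N = n.+1) :
  (forall i, q i \is monic) -> decomp A^T q u ->
  A ~_{in unitmx}
      castmx (eq_n, eq_n) (\mxdiag_(i < m) companion (size (q i)).-1 (q i)).
Proof.
move=> qm dec.
pose Q := \mxcol_(i < m) krylov A^T (size (q i)).-1 (u i).
pose Q' : 'M_n.+1 := castmx (eq_n, erefl n.+1) Q.
have QA : Q *m A^T = (\mxdiag_(i < m) companion (size (q i)).-1 (q i))^T *m Q.
  rewrite tr_mxdiag mul_mxdiag_mxcol mxcol_mul; apply: eq_mxcol => i.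
  by apply: krylov_companion => //; apply/(decomp_act0 _ _ dec).
have Qu : Q'^T \in unitmx.
  rewrite unitmx_tr -row_free_unit row_free_castmx -kermx_eq0.
  apply/eqP/row_matrixP => i; rewrite row0; set y := row i _.
  have : y *m Q = 0 by rewrite -row_mul mulmx_ker row0.
  rewrite -[y]submxrowK mul_mxrow_mxcol.
  under eq_bigr do rewrite mul_krylov.
  move=> /(dec (fun i => rVpoly _)) yq; rewrite -[RHS]mxrow0;
    apply: eq_mxrow => j.
  apply/(can_inj rVpolyK); rewrite linear0; apply/eqP; apply/negPn/negP => y0.
  have := leq_trans (dvdp_leq y0 (yq j)) (size_poly _ _).
  by rewrite leqNgt ltn_predL size_poly_gt0 monic_neq0.
exists (invmx Q'^T); rewrite ?unitmx_inv// /simmx_to_for /= mxpoly.conjVmx//.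
apply/eqP; apply: (can_inj (mulKmx Qu)); rewrite /= -mulmxA mulKVmx//.
apply: trmx_inj; rewrite !trmx_mul !trmxK trmx_cast /= castmx_mulr castmx_mull.
by rewrite QA.
Qed.

End Krylov.

(** * The module of a polynomial in a companion matrix *)

Section Companion.
Variables (F : fieldType).

Lemma horner_mx_comp n (B : 'M[F]_n.+1) g h :
  horner_mx (horner_mx B g) h = horner_mx B (h \Po g).
Proof.
elim/poly_ind: h => [|h c IH]; first by rewrite comp_poly0 !rmorph0.
rewrite comp_polyD comp_polyC comp_polyM comp_polyX !rmorphD !rmorphM /=.
by rewrite IH !horner_mx_X !horner_mx_C.
Qed.

(** The first basis vector is cyclic for a transposed companion matrix, its
    iterates being the standard basis. *)
Lemma krylov_companion_id n (f : {poly F}) :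
  krylov (companion n.+1 f)^T n.+1 (delta_mx 0 ord0) = 1%:M.
Proof.
apply/row_matrixP => i; rewrite rowK row1.
case: i => i; elim: i => [|i IH] ilt.
  by rewrite expr0 rmorph1 mulmx1; congr (delta_mx _ _); apply: val_inj.
rewrite exprSr act_hornerM IH ?(ltnW ilt)// => ilt'.
rewrite /= horner_mx_X -rowE; apply/rowP => j; rewrite !mxE /=.
by rewrite ltn_eqF.
Qed.

(** The annihilator of the first basis vector is generated by [f]. *)
Lemma companion_cyclic n (f h : {poly F}) : f \is monic -> size f = n.+2 ->
  (delta_mx 0 ord0 *m horner_mx (companion n.+1 f)^T h == 0 :> 'rV_n.+1) =
    (f %| h).
Proof.
move=> fm fs; set B := (_)^T; set e := delta_mx _ _.
have eK (y : 'rV_n.+1) : e *m horner_mx B (rVpoly y) = y.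
  by rewrite -mul_krylov krylov_companion_id mulmx1.
have ef : e *m horner_mx B f = 0.
  (* The last row of [B] holds the coefficients of [X^(n+1) - f]. *)
  have -> : f = 'X * 'X^n - rVpoly (row ord_max B).
    apply/polyP => i; rewrite coefB -exprS coefXn coef_rVpoly.
    case: insubP => [k ik kE|ik].
      by rewrite !mxE eqxx -kE opprK ltn_eqF ?ltn_ord// add0r.
    rewrite subr0; have := ik; rewrite -leqNgt leq_eqVlt => /predU1P[<-|ik'].
      by rewrite eqxx; move/monicP: fm; rewrite lead_coefE fs => ->.
    by rewrite gtn_eqF// nth_default// fs.
  rewrite rmorphB /= mulmxBr eK mulrC act_hornerM horner_mx_X.
  have -> : e *m horner_mx B 'X^n = delta_mx 0 ord_max.
    have /(congr1 (row ord_max)) := krylov_companion_id n f.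
    by rewrite rowK row1.
  by rewrite -rowE subrr.
apply/eqP/idP => [eh|fh]; last exact: act_dvdp fh ef.
rewrite /dvdp; set r := h %% f.
have rs : (size r <= n.+1)%N by rewrite -ltnS -fs ltn_modp monic_neq0.
have er : e *m horner_mx B r = 0.
  move: eh; rewrite {1}(divp_eq h f) rmorphD /= mulmxDr mulrC act_hornerM ef.
  by rewrite mul0mx add0r.
by rewrite -(poly_rV_K rs) -{1}(eK (poly_rV r)) poly_rV_K// er linear0.
Qed.

Lemma coprime_prodr (I : finType) (P : pred I) (f : {poly F}) (k : I ->
  {poly F}) :
  (forall i, P i -> coprimep f (k i)) -> coprimep f (\prod_(i | P i) k i).
Proof.
move=> H; elim/big_ind : _ => // [|x y fx fy]; first exact: coprimep1.
by rewrite coprimepMr fx.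
Qed.

Lemma dvdp_sum (I : finType) (P : pred I) (f : {poly F}) (k : I -> {poly F}) :
  (forall i, P i -> f %| k i) -> f %| \sum_(i | P i) k i.
Proof.
by move=> H; elim/big_ind : _ => // x y; apply: dvdp_add.
Qed.

Section Chinese.
Variables (m : nat) (f : 'I_m -> {poly F}).
Hypothesis cop : forall i j, i != j -> coprimep (f i) (f j).
Let cof i := \prod_(j | j != i) f j.

Lemma coprime_cof i : coprimep (f i) (cof i).
Proof. by apply: coprime_prodr => j ji; apply: cop; rewrite eq_sym. Qed.

Lemma dvdp_cof i j : j != i -> f j %| cof i.
Proof. by move=> ji; rewrite /cof (bigD1 j)//= dvdp_mulr. Qed.

(** The cofactor [cof i] is the product of all [f j] with [j] different from
    [i]. *)
Lemma dvdp_sum_cof (k : 'I_m -> {poly F}) :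
  (\prod_i f i %| \sum_i cof i * k i) <-> forall i, f i %| k i.
Proof.
split=> [H i|H].
  have: f i %| \sum_i cof i * k i.
    by apply: dvdp_trans H; rewrite (bigD1 i)//= dvdp_mulr.
  rewrite (bigD1 i)//= dvdp_addl; last first.
    apply: dvdp_sum => j ji.
    by rewrite dvdp_mulr// dvdp_cof// eq_sym.
  by rewrite Gauss_dvdpr ?coprime_cof.
apply: dvdp_sum => j _.
by rewrite (bigD1 j)//= mulrC dvdp_mul.
Qed.

Lemma poly_chinese (k : 'I_m -> {poly F}) : exists g, forall i, f i %| g - k i.
Proof.
have /choice[c cE] : forall i, exists c, f i %| cof i * c - 1.
  move=> i; have /Bezout_eq1_coprimepP[[a b] /= ab] := coprime_cof i.
  exists b; rewrite -ab mulrC opprD addrCA subrr addr0 dvdpNr dvdp_mull//.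
exists (\sum_i cof i * c i * k i) => i; rewrite (bigD1 i)//= addrAC.
rewrite dvdp_add//.
  by rewrite -{2}[k i]mul1r -mulrBl dvdp_mulr.
apply: dvdp_sum => j ji.
by rewrite -mulrA dvdp_mulr// dvdp_cof// eq_sym.
Qed.

End Chinese.

Lemma dvdp_comp_congr (f g l h : {poly F}) :
  f %| g - l -> (f %| h \Po g) = (f %| h \Po l).
Proof.
move=> fgl; have fd : f %| (h \Po g) - (h \Po l).
  elim/poly_ind: h => [|h c IH]; first by rewrite !comp_poly0 subrr dvdp0.
  rewrite !comp_polyD !comp_polyC !comp_polyM !comp_polyX.
  rewrite [_ + c%:P]addrC [_ + c%:P]addrC opprD addrACA subrr add0r.
  rewrite (_ : _ - _ = ((h \Po g) - (h \Po l)) * g + (h \Po l) * (g - l)).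
    by apply: dvdp_add; [apply: dvdp_mulr | apply: dvdp_mull].
  by rewrite mulrBl mulrBr addrA subrK.
by rewrite -[h \Po g](subrK (h \Po l)) dvdp_addr.
Qed.

(** Pulling back along [X -> g] the primary decomposition of the cyclic
    module [F[X]/(\prod_i f i)]: the [i]-th generator is the cofactor of [f
    i], and its annihilator for the new action is generated by [q i], since
    [f i] divides [h \Po g] iff [q i] divides [h]. *)
Lemma decomp_companion n m (f q : 'I_m -> {poly F}) (g : {poly F}) :
  (forall i, f i \is monic) -> size (\prod_i f i) = n.+2 ->
  (forall i j, i != j -> coprimep (f i) (f j)) ->
  (forall i h, (f i %| h \Po g) = (q i %| h)) ->
  exists u, decomp (horner_mx (companion n.+1 (\prod_i f i)) g)^T q u.
Proof.
move=> fm fs cop fq; rewrite horner_mx_tr; set B := (_)^T.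
exists (fun i => delta_mx 0 ord0 *m horner_mx B (\prod_(j | j != i) f j)) => h.
have -> : (forall i, q i %| h i) <-> (forall i, f i %| h i \Po g).
  by split=> H i; move: (H i); rewrite fq.
rewrite -(dvdp_sum_cof cop) -(companion_cyclic _ _ fs) ?monic_prod//.
rewrite (_ : \sum_i _ = delta_mx 0 ord0 *m
  horner_mx B (\sum_i (\prod_(j | j != i) f j) * (h i \Po g))).
  by split => /eqP.
rewrite rmorph_sum /= mulmx_sumr; apply: eq_bigr => i _.
by rewrite act_hornerM horner_mx_comp.
Qed.

End Companion.

(** * Existence of elementary divisors *)

Section Existence.
Variables (F : fieldType) (n : nat) (B : 'M[F]_n.+1).
Implicit Types (v w t : 'rV[F]_n.+1) (W : 'M[F]_n.+1) (h p q : {poly F}).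

Local Notation act h v := (v *m horner_mx B h).

Lemma act_stable W h v : stablemx W B -> (v <= W)%MS -> (act h v <= W)%MS.
Proof.
by move=> WB vW; apply: submx_trans (submxMr _ vW) (horner_mx_stable _ WB).
Qed.

(** A nonzero polynomial of least degree killing some nonzero vector of [W]
    is irreducible. *)
Lemma exists_irreducible_act W v : (v <= W)%MS -> stablemx W B -> v != 0 ->
  exists p w,
    [/\ p \is monic, irreducible_poly p, (w <= W)%MS, w != 0 & act p w = 0].
Proof.
move=> vW WB v0.
pose P k := `[< exists h w,
  [/\ h != 0, size h = k, (w <= W)%MS, w != 0 & act h w = 0] >].
have exP : exists k, P k.
  exists (size (mxminpoly B)); apply/asboolP; exists (mxminpoly B), v;
    split=> //.
    by rewrite monic_neq0// mxminpoly_monic.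
  by rewrite mx_root_minpoly mulmx0.
case: (ex_minnP exP) => k /asboolP[h [w [h0 hk wW w0 hw]]] kmin.
have irh : irreducible_poly h.
  split.
    rewrite ltnNge; apply/negP => /size1_polyC hE; move: hw w0 h0.
    rewrite hE horner_mx_C mul_mx_scalar => /eqP.
    by rewrite scaler_eq0 => /orP[/eqP->|->//]; rewrite polyC0 eqxx.
  move=> q q1 qh; have := qh => /dvdpP[c hE].
  have [c0 q0] : c != 0 /\ q != 0 by move: h0;
    rewrite hE mulf_eq0 negb_or => /andP.
  have cw : act c w != 0.
    apply/eqP => cw; have : (k <= size c)%N by apply: kmin; apply/asboolP;
      exists c, w.
    rewrite -hk hE size_mul//; move: q0 q1; rewrite -size_poly_gt0.
    by case: (size q) => [|[|s]]// _ _; rewrite !addnS /= ltnNge leq_addr.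
  have : (k <= size q)%N.
    apply: kmin; apply/asboolP; exists q, (act c w); split=> //.
      exact: act_stable.
    by rewrite -act_hornerM -hE.
  by rewrite -hk -dvdp_size_eqp// eqn_leq dvdp_leq// => ->.
exists ((lead_coef h)^-1 *: h), w; split=> //.
- by apply/monicP; rewrite lead_coefZ mulVf// lead_coef_eq0.
- have lc : (lead_coef h)^-1 != 0 by rewrite invr_eq0 lead_coef_eq0.
  split; first by rewrite size_scale// irh.
  move=> q q1; rewrite dvdpZr// => /(irh _ q1) qh.
  by rewrite (eqp_trans qh)// eqp_sym eqp_scale.
by rewrite linearZ /= -scalemxAr hw scaler0.
Qed.

(** A vector killed by [p ^+ a.+1] but not by [p ^+ a] has annihilator
    generated by [p ^+ a.+1]. *)
Lemma act_irreducible_exp p v a h : irreducible_poly p ->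
  act (p ^+ a.+1) v = 0 -> act (p ^+ a) v != 0 -> act h v = 0 -> p ^+ a.+1 %| h.
Proof.
move=> irp; have [p1 pi] := irp.
have p0 := irredp_neq0 irp.
elim: a v h => [|a IH] v h.
  rewrite expr0 expr1 rmorph1 mulmx1 => pv v0 hv.
  apply/negPn/negP => pNh; case/eqP: v0; apply: (act_coprime _ hv pv).
  by rewrite coprimep_sym irreducible_poly_coprime.
rewrite exprS => pv pv' hv; have : p ^+ a.+1 %| h.
  apply: (IH (act p v)); rewrite -?act_hornerM -?exprS//.
  by rewrite mulrC act_hornerM hv mul0mx.
case/dvdpP => k hE; rewrite hE dvdp_mul2r ?expf_neq0//.
apply/negPn/negP => pNk; case/eqP: pv'.
apply: (@act_coprime _ _ B _ k p);
  first by rewrite coprimep_sym irreducible_poly_coprime.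
  by rewrite -act_hornerM mulrC -hE.
by rewrite -act_hornerM mulrC.
Qed.

(** A vector of [W] whose annihilator is the highest possible power of [p];
    the exponents are bounded because [p ^+ a.+1] divides the minimal
    polynomial of [B]. *)
Lemma max_order_vector W p w : irreducible_poly p -> stablemx W B ->
  (w <= W)%MS -> w != 0 -> act p w = 0 ->
  exists a v, [/\ (v <= W)%MS, act (p ^+ a.+1) v = 0, act (p ^+ a) v != 0 &
    forall t b, (t <= W)%MS -> act (p ^+ b) t = 0 -> act (p ^+ a.+1) t = 0].
Proof.
move=> irp WB wW w0 pw.
pose P a := `[< exists v, [/\ (v <= W)%MS,
  act (p ^+ a.+1) v = 0 & act (p ^+ a) v != 0] >].
have exP : exists a, P a.
  by exists 0%N; apply/asboolP; exists w; split=> //;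
    rewrite expr0 rmorph1 mulmx1.
have ubP a : P a -> (a <= size (mxminpoly B))%N.
  case/asboolP => v [vW v1 v2]; have mu0 : mxminpoly B != 0.
    by rewrite monic_neq0// mxminpoly_monic.
  have /(dvdp_leq mu0) : p ^+ a.+1 %| mxminpoly B.
    by apply: act_irreducible_exp v1 v2 _; rewrite ?mx_root_minpoly ?mulmx0.
  apply: leq_trans; have := size_exp p a.+1; have [p1 _] := irp.
  move=> sE; rewrite (leq_trans _ (leq_pred _))// sE.
  by rewrite (leq_trans (leqnSn a))// leq_pmull// -ltnS prednK// ltnW.
case: (ex_maxnP exP ubP) => a /asboolP[v [vW v1 v2]] amax.
exists a, v; split=> // t b tW; elim: b => [|b IH].
  by move=> t0; rewrite (act_dvdp _ t0)// expr0 dvd1p.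
have [ba|ab] := leqP b a.
  by apply: act_dvdp; rewrite dvdp_exp2l.
move=> tb; apply: IH; apply/eqP/negPn/negP => tb'.
have : P b by apply/asboolP; exists t.
by move=> /amax; rewrite leqNgt ab.
Qed.

(** Here [v] in [W] has annihilator generated by [q = p ^+ a.+1], of degree
    [d], and no vector of [W] has a higher power of [p] as annihilator. *)
Section Split.
Variables (W : 'M[F]_n.+1) (p : {poly F}) (a : nat) (v : 'rV[F]_n.+1).
Hypothesis WB : stablemx W B.
Hypothesis irp : irreducible_poly p.
Hypothesis vW : (v <= W)%MS.
Hypothesis v1 : act (p ^+ a.+1) v = 0.
Hypothesis v2 : act (p ^+ a) v != 0.
Hypothesis vmax : forall t b, (t <= W)%MS -> act (p ^+ b) t = 0 ->
  act (p ^+ a.+1) t = 0.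
Let q := p ^+ a.+1.
Let d := (size q).-1.

Let q0 : q != 0.
Proof. by rewrite expf_neq0// irredp_neq0. Qed.

Let dE : size q = d.+1.
Proof. by rewrite /d prednK// size_poly_gt0. Qed.

Let d_gt0 : (0 < d)%N.
Proof.
by have [p1 _] := irp; rewrite /d size_exp muln_gt0 andbT -ltnS prednK// ltnW.
Qed.

(** The last Krylov vector [v B^(d-1)] is independent of the previous ones
    modulo [W q(B)]: a relation would read [v h(B) = w q(B)] with [h] monic
    of degree [d - 1]; then [q ^+ 2] kills [w], so [q] does by maximality,
    and [h] would kill [v]. *)
Lemma split_functional : exists phi : 'cV[F]_n.+1,
  [/\ W *m horner_mx B q *m phi = 0, krylov B d.-1 v *m phi = 0 &
      act 'X^(d.-1) v *m phi != 0].
Proof.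
set x := act 'X^(d.-1) v.
pose K := col_mx (krylov B d.-1 v) (W *m horner_mx B q).
have xK : ~~ (x <= K)%MS.
  apply/negP => /submxP[y]; rewrite -[y]hsubmxK mul_row_col mul_krylov mulmxA.
  set w := _ *m W; set r := rVpoly _ => /eqP;
    rewrite addrC -subr_eq -mulmxBr -rmorphB /= => /eqP xE.
  have wW : (w <= W)%MS by apply: submxMl.
  have wq : act q w = 0.
    apply: (vmax (b := (a.+1 + a.+1)%N) wW).
    by rewrite exprD act_hornerM -xE -act_hornerM mulrC act_hornerM v1 mul0mx.
  rewrite wq in xE.
  have rs : (size r < size ('X^(d.-1) : {poly F}))%N.
    by rewrite size_polyXn ltnS size_poly.
  have := act_irreducible_exp irp v1 v2 xE; rewrite -/q => /dvdp_leq.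
  rewrite -size_poly_eq0 size_polyDl ?size_polyN// size_polyXn /= => /(_ isT).
  by rewrite dE prednK// ltnn.
move: xK; rewrite submxE => /rV0Pn[j xj].
exists (col j (cokermx K)); rewrite colE.
have KC : K *m (cokermx K *m delta_mx j (0 : 'I_1)) = 0.
  by rewrite mulmxA mulmx_coker mul0mx.
move: KC; rewrite mul_col_mx => /eqP;
  rewrite col_mx_eq0 => /andP[/eqP-> /eqP->].
split=> //; rewrite mulmxA -colE;
  apply: contra xj => /eqP/matrixP/(_ ord0 ord0).
by rewrite !mxE => ->.
Qed.

(** The complement of the cyclic module of [v] is the set of [w] in [W] on
    which all [phi (w B^j)] vanish.  Since [phi] kills [W q(B)], the
    conditions with [j < d] imply the others, so that the set is stable and
    has codimension at most [d]; it meets the cyclic module of [v] trivially,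
    since [phi] detects the top Krylov vector. *)
Lemma split_complement : exists W' : 'M[F]_n.+1,
  [/\ stablemx W' B, (W' <= W)%MS, \rank W = (d + \rank W')%N &
      forall h, (act h v <= W')%MS -> q %| h].
Proof.
have [phi [phiW phiv phix]] := split_functional.
pose D := \matrix_(i < n.+1, j < d) (horner_mx B 'X^j *m phi) i 0.
have DE (w : 'rV_n.+1) :
    w *m D = 0 <-> forall j, (j < d)%N -> act 'X^j w *m phi = 0.
  have DE' j : (w *m D) 0 j = (act 'X^j w *m phi) 0 0.
    by rewrite -mulmxA !mxE; apply: eq_bigr => i _; rewrite [D _ _]mxE.
  split=> [wD j jd|H].
    rewrite [LHS]mx11_scalar -(DE' (Ordinal jd)) wD mxE.
    by apply/matrixP => i k; rewrite !mxE mul0rn.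
  by apply/rowP => j; rewrite DE' H// !mxE.
(* Reduction modulo [q] leaves only degrees below [d]. *)
have DP (w : 'rV_n.+1) : (w <= W)%MS -> w *m D = 0 ->
    forall h, act h w *m phi = 0.
  move=> wW /DE wD h; rewrite (divp_eq h q) rmorphD /= mulmxDr mulmxDl.
  rewrite act_hornerM.
  have /submxP[y ->] : (act (h %/ q) w <= W)%MS by apply: act_stable.
  rewrite -[y *m W *m _]mulmxA -[y *m _ *m phi]mulmxA phiW mulmx0 add0r.
  rewrite -[h %% q]coefK poly_def linear_sum /= mulmx_sumr mulmx_suml.
  apply: big1 => j _.
  rewrite linearZ /= -scalemxAr -scalemxAl wD ?scaler0//.
  by rewrite (leq_trans (ltn_ord j))// -ltnS -dE ltn_modp.
exists (W :&: kermx D)%MS.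
have inW' (w : 'rV_n.+1) :
    (w <= W :&: kermx D)%MS <-> (w <= W)%MS /\ w *m D = 0.
  by rewrite sub_capmx; split=> [/andP[? /sub_kermxP]|[? /sub_kermxP->]]//;
    rewrite andbT.
have stab : stablemx (W :&: kermx D)%MS B.
  apply/row_subP => i; rewrite row_mul; set w := row i _.
  have [wW wD] : (w <= W)%MS /\ w *m D = 0 by apply/inW'/row_sub.
  apply/inW'; have wB : w *m B = act 'X w by rewrite horner_mx_X.
  split; first by rewrite wB; apply: act_stable.
  by apply/DE => j _; rewrite wB -act_hornerM DP.
have ann h : (act h v <= W :&: kermx D)%MS -> q %| h.
  move=> /inW'[_ hD]; rewrite /dvdp; apply/negPn/negP; set r := h %% q => r0.
  have rs : (size r <= d)%N by rewrite -ltnS -dE ltn_modp.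
  have hr : act h v = act r v.
    rewrite {1}(divp_eq h q) rmorphD /= mulmxDr mulrC act_hornerM v1.
    by rewrite mul0mx add0r.
  (* Multiplying [r] by a power of [X] brings its degree to [d - 1], where [phi]
     sees only the leading coefficient. *)
  have := DP _ (act_stable h WB vW) hD 'X^(d - size r).
  rewrite hr -act_hornerM; set k := r * _ => kphi; case/eqP: phix.
  have kd : k`_d.-1 != 0.
    rewrite coefMXn ltnNge (_ : (d - size r <= d.-1)%N); last first.
      by rewrite -ltnS prednK// ltn_subrL size_poly_gt0 r0.
    have -> : (d.-1 - (d - size r) = (size r).-1)%N.
      by rewrite -subn1 subnAC subKn// subn1.
    by rewrite -lead_coefE lead_coef_eq0.
  have ks : (size k <= d)%N.
    by rewrite size_mulXn// addnC subnKC// subnK.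
  have kE : k = k`_d.-1 *: 'X^(d.-1) + rVpoly (poly_rV k : 'rV_d.-1).
    apply/polyP => i; rewrite coefD coefZ coefXn coef_rVpoly.
    case: insubP => [i' il <-|il].
      by rewrite mxE ltn_eqF ?ltn_ord// mulr0 add0r.
    have := il; rewrite -leqNgt leq_eqVlt => /predU1P[<-|il'].
      by rewrite eqxx mulr1 addr0.
    rewrite gtn_eqF// mulr0 addr0 nth_default//.
    by rewrite (leq_trans ks)// -[d]prednK.
  move: kphi; rewrite kE rmorphD /= linearZ /= mulmxDr mulmxDl -mul_krylov.
  rewrite -mulmxA phiv mulmx0 addr0 -scalemxAr -scalemxAl => /eqP.
  by rewrite scaler_eq0 (negPf kd) => /eqP.
split=> //; first exact: capmxSl.
(* The rank of [W *m D] is [d], since [D] is injective on the Krylov space. *)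
suff WD : \rank (W *m D) = d by rewrite -(mxrank_mul_ker W D) WD.
apply/eqP; rewrite eqn_leq rank_leq_col.
have UW : (krylov B d v <= W)%MS.
  by apply/row_subP => i; rewrite rowK; apply: act_stable.
apply: leq_trans (mxrankS (submxMr D UW)).
suff /eqP-> : row_free (krylov B d v *m D) by [].
rewrite -kermx_eq0.
apply/eqP/row_matrixP => i; rewrite row0; set y := row i _.
have : y *m (krylov B d v *m D) = 0 by rewrite -row_mul mulmx_ker row0.
rewrite mulmxA mul_krylov => yD.
have qy : q %| rVpoly y by apply: ann; apply/inW'; split=> //;
  apply: act_stable.
apply/(can_inj rVpolyK); rewrite linear0; apply/eqP/negPn/negP => y0.
have := leq_trans (dvdp_leq y0 qy) (size_poly _ _).
by rewrite dE ltnn.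
Qed.

End Split.

(** The family [x] followed by [f]. *)
Definition fcons (T : Type) m (x : T) (f : 'I_m -> T) (i : 'I_m.+1) : T :=
  if unlift ord0 i is Some j then f j else x.

Lemma fcons0 T m (x : T) (f : 'I_m -> T) : fcons x f ord0 = x.
Proof. by rewrite /fcons unlift_none. Qed.

Lemma fconsS T m (x : T) (f : 'I_m -> T) i : fcons x f (lift ord0 i) = f i.
Proof. by rewrite /fcons liftK. Qed.

Lemma forall_ordS m (P : 'I_m.+1 -> Prop) :
  (forall i, P i) <-> P ord0 /\ forall i, P (lift ord0 i).
Proof.
split=> [H|[H0 HS] i]; first by split=> // i; apply: H.
by case: (unliftP ord0 i) => [j|] ->.
Qed.

Lemma stable_primary_decomposition W : stablemx W B ->
  exists m (p : 'I_m -> {poly F}) (e : 'I_m -> nat) (u : 'I_m -> 'rV[F]_n.+1),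
    [/\ forall i, [/\ p i \is monic, irreducible_poly (p i) & (0 < e i)%N],
        forall i, (u i <= W)%MS,
        decomp B (fun i => p i ^+ e i) u &
        (\sum_i (size (p i ^+ e i)%R).-1 = \rank W)%N].
Proof.
have [k] := ubnP (\rank W); elim: k W => // k IH W Wk WB.
have [W0|W0] := eqVneq W 0.
  exists 0%N, (fun=> 0), (fun=> 0%N), (fun=> 0).
  split=> [[]|[]|h|]//; last by rewrite big_ord0 W0 mxrank0.
  by rewrite big_ord0; split=> // _ [].
have nW0 : nz_row W != 0 by rewrite nz_row_eq0.
have [p [w [pm irp wW w0 pw]]] :=
  exists_irreducible_act (nz_row_sub W) WB nW0.
have [a [v [vW v1 v2 vmax]]] := max_order_vector irp WB wW w0 pw.
have [W' [W'B W'W rW W'v]] := split_complement WB irp vW v1 v2 vmax.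
have d0 : (0 < (size (p ^+ a.+1)).-1)%N.
  by have [p1 _] := irp; rewrite size_exp muln_gt0 andbT -ltnS prednK// ltnW.
have [|m [p' [e' [u' [pe' uW' dec' rW']]]]] := IH _ _ W'B.
  by rewrite -ltnS (leq_trans _ Wk)// rW !ltnS -[X in (X < _)%N]add0n ltn_add2r.
exists m.+1, (fcons p p'), (fcons a.+1 e'), (fcons v u'); split.
- by apply/forall_ordS; rewrite !fcons0; split=> // i; rewrite !fconsS.
- apply/forall_ordS; rewrite !fcons0; split=> // i; rewrite !fconsS.
  exact: submx_trans W'W.
- move=> h; rewrite big_ord_recl (forall_ordS (fun i => _ %| h i)) !fcons0.
  under eq_bigr do rewrite fconsS.
  have -> : (forall i, fcons p p' (lift ord0 i) ^+ fcons a.+1 e' (lift ord0 i)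
      %| h (lift ord0 i)) <-> (forall i, p' i ^+ e' i %| h (lift ord0 i)).
    by split=> H i; move: (H i); rewrite !fconsS.
  split=> [sum0|[vh]].
    have vh : p ^+ a.+1 %| h ord0.
      apply: W'v; move/eqP: sum0; rewrite addr_eq0 => /eqP->.
      rewrite eqmx_opp summx_sub// => i _; exact: act_stable.
    split=> //; apply/(dec' (fun i => h (lift ord0 i))).
    by move: sum0; rewrite (act_dvdp vh v1) add0r.
  by move=> /(dec' (fun i => h (lift ord0 i))) ->;
    rewrite (act_dvdp vh v1) add0r.
- rewrite big_ord_recl !fcons0 rW -rW'; congr (_ + _)%N.
  by apply: eq_bigr => i _; rewrite !fconsS.
Qed.

End Existence.

(** * Stabilizers over a finite field *)

Section FiniteField.

(** The group of units of the finite field [F[X]/(P)] is cyclic. *)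
Lemma irreducible_residue_generator (F : finFieldType) (P : {poly F}) :
  P \is monic -> irreducible_poly P ->
  exists2 g : {poly F}, ~~ (P %| g) &
    forall h, ~~ (P %| h) -> exists k, P %| h - g ^+ k.
Proof.
move=> Pm Pi; pose mi : monic_irreducible_poly P := (Pi, Pm).
pose L : finFieldType := {poly %/ P with mi}.
have in0 h : (in_qpoly P h == 0) = (P %| h).
  apply/eqP/idP => [/val_eqP /= |hDp].
    by rewrite -Pdiv.IdomainMonic.modpE mk_monicE.
  by apply/val_eqP; rewrite /= -Pdiv.IdomainMonic.modpE mk_monicE.
have /cyclicP[x xE] := field_unit_group_cyclic [set: {unit L}]%G.
pose g : {poly F} := val (FinRing.uval x : {poly %/ P}).
have gE : in_qpoly P g = FinRing.uval x.
  by apply: val_inj; rewrite [LHS]in_qpoly_small// size_mk_monic.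
exists g => [|h hP].
  by rewrite -in0 gE; have := valP x; rewrite unitfE.
have hU : (in_qpoly P h : L) \in GRing.unit by rewrite unitfE in0.
have : FinRing.unit _ hU \in <[x]>%g by rewrite -xE inE.
case/cycleP => k kE; exists k; rewrite -in0.
rewrite raddfB /= rmorphXn /= gE subr_eq0; apply/eqP.
have /(congr1 (@FinRing.uval _)) := kE.
by rewrite FinRing.val_unitX /= => ->.
Qed.

Section SeqFinite.
Variables (F : fieldType) (s : seq F).
Hypothesis sP : forall x, x \in s.

Lemma seq_pickleK : pcancel (fun x => index x (undup s)) (onth (undup s)).
Proof.
by move=> x; rewrite onthE (nth_map x) ?nth_index ?index_mem ?mem_undup.
Qed.

Lemma seq_enumP : Finite.axiom (undup s).
Proof. by move=> x; rewrite count_uniq_mem ?undup_uniq// mem_undup sP. Qed.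

(** A field enumerated by a list, as a finite field whose underlying field is
    [F] itself up to conversion. *)
Definition finite_field : finFieldType :=
  HB.pack_for finFieldType (GRing.Field.sort F)
    (isCountable.Build F seq_pickleK) (isFinite.Build F seq_enumP).

End SeqFinite.

(** The substitutions [X -> X + b] and [X -> a X] preserve divisibility by
    [P] and act on the powers of a generator [g] of the units modulo [P] as
    the power maps of exponents [j] and [k]; these commute.  Comparing the
    two composites at [X] shows that [P] divides the constant [(a - 1) b]. *)
Lemma stabilizers_finite_field (F : fieldType) (s : seq F) (P : {poly F}) a b :
  (forall x, x \in s) -> P \is monic -> irreducible_poly P ->
  a != 0 -> b != 0 ->
  Omega_act 1 b P = P -> Omega_act a 0 P = P -> a = 1.
Proof.
move=> sP Pm Pi a0 b0 Pb Pa.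
have [g gN0 gP] := @irreducible_residue_generator (finite_field sP) P Pm Pi.
have Pg h : ~~ (P %| h) -> exists k, P %| h - g ^+ k by exact: gP.
have comp_congr c d j : c != 0 -> Omega_act c d P = P ->
    P %| (g \Po aff c d) - g ^+ j -> forall h l, P %| h - g ^+ l ->
    P %| (h \Po aff c d) - g ^+ (j * l).
  move=> c0 Pcd gj h l hl.
  rewrite -(subrK ((g \Po aff c d) ^+ l) (h \Po _)) -addrA dvdp_add//.
    by rewrite -rmorphXn -comp_polyB -{1}Pcd dvdp_Omega_act.
  by rewrite exprM subrXX dvdp_mulr.
have PbN0 c : c != 0 -> ~~ (P %| c%:P).
  by move=> c0; have [p1 _] := Pi; rewrite gtNdvdp ?polyC_eq0// size_polyC c0.
(* Otherwise [P] divides [X], hence [X + b], hence [b]. *)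
have [l Xl] : exists l, P %| 'X - g ^+ l.
  apply: Pg; apply/negP => PX; have := PbN0 _ b0.
  have : P %| 'X \Po aff 1 b by rewrite -{1}Pb dvdp_Omega_act ?oner_neq0.
  by rewrite comp_polyX /aff scale1r dvdp_addr// => ->.
have [j gj] : exists j, P %| (g \Po aff 1 b) - g ^+ j.
  by apply: Pg; rewrite -{1}Pb dvdp_Omega_act ?oner_neq0.
have [k gk] : exists k, P %| (g \Po aff a 0) - g ^+ k.
  by apply: Pg; rewrite -{1}Pa dvdp_Omega_act.
have c1 := comp_congr _ _ _ a0 Pa gk _ _
  (comp_congr _ _ _ (oner_neq0 _) Pb gj _ _ Xl).
have c2 := comp_congr _ _ _ (oner_neq0 _) Pb gj _ _
  (comp_congr _ _ _ a0 Pa gk _ _ Xl).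
apply/eqP; rewrite -subr_eq0; apply/negPn/negP => a1.
have : P %| (((a - 1) * b)%:P : {poly F}).
  rewrite mulnCA in c2; have := dvdp_sub c2 c1; rewrite opprB addrA subrK.
  rewrite !comp_polyX !comp_aff /aff !(mul1r, mulr1, addr0, add0r).
  by rewrite opprD addrACA subrr add0r -polyCB mulrBl mul1r.
by apply/negP/PbN0; rewrite mulf_neq0.
Qed.

End FiniteField.

(** * Size of the orbits *)

Section Orbit.
Variable F : fieldType.
Implicit Types (P : {poly F}) (a b : F).

(** A map on the type of naturals stands for one defined below [k]; [x0] is
    its value elsewhere. *)
Lemma card_le_injection (T : Type) (B : set T) k (x0 : T) : card_le `I_k B ->
  exists s : nat -> T, (forall i, (i < k)%N -> B (s i)) /\
    (forall i j, (i < k)%N -> (j < k)%N -> s i = s j -> i = j).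
Proof.
move=> /card_leP[f].
pose s i := if insub i is Some j
  then val (f (SigSub (mem_set (ltn_ord (j : 'I_k)) : nat_of_ord j \in `I_k)))
  else x0.
exists s; split=> [i ik|i j ik jk]; rewrite /s.
  by rewrite insubT; apply/set_mem/valP.
rewrite !insubT => /val_inj/(inj (f := f)).
by rewrite !inE => /(_ I I) [].
Qed.

Lemma add_stabE P b : add_stab P b <-> Omega_act 1 b P = P.
Proof.
by rewrite /add_stab /= Omega_actE expr1n invr1 scale1r /aff scale1r.
Qed.

Lemma mul_stabE P a : mul_stab P a <-> a != 0 /\ Omega_act a 0 P = P.
Proof. by rewrite /mul_stab /= Omega_actE /aff addr0. Qed.

Lemma Omega_act_eq P a b c d : a != 0 -> c != 0 ->
  Omega_act a b P = Omega_act c d P ->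
  Omega_act (a / c) (b - a * (d / c)) P = P.
Proof.
move=> a0 c0 /(congr1 (Omega_act c^-1 (- (d / c)))).
rewrite !Omega_act_comp// divff// !mulrN [c * _]mulrC divfK// addNr Omega_act10.
by rewrite addrC.
Qed.

(** A new value exists because [P - c] has finitely many roots for each of
    the finitely many values [c] already taken. *)
Lemma infinite_distinct_values P k : (1 < size P)%N ->
  (forall s : seq F, exists x, x \notin s) ->
  exists s : seq F, size s = k /\ uniq [seq P.[x] | x <- s].
Proof.
move=> P1 infF.
have uniq_seq l : exists s : seq F, size s = l /\ uniq s.
  elim: l => [|l [s [<- us]]]; first by exists [::].
  by have [x xs] := infF s; exists (x :: s); rewrite /= xs.
elim: k => [|k [s [<- us]]]; first by exists [::].
pose R := \prod_(x <- s) (P - P.[x]%:P).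
have R0 : R != 0.
  rewrite prodf_seq_neq0; apply/allP => x _ /=; rewrite subr_eq0.
  by apply/eqP => PE; move: P1; rewrite PE ltnNge size_polyC leq_b1.
have [t [ts ut]] := uniq_seq (size R).
have /allPn[x _ Rx] : ~~ all (root R) t.
  by apply/negP => tR; have := max_poly_roots R0 tR ut; rewrite ts ltnn.
exists (x :: s); split=> //=; rewrite us andbT; apply/negP => /mapP[y ys xy].
case/negP: Rx; rewrite /root /R horner_prod prodf_seq_eq0; apply/hasP.
by exists y => //=; rewrite !hornerE xy subrr.
Qed.

(** Under the cardinality hypotheses, the orbit of [P] contains at least [k]
    elements. *)
Lemma orbit_injection P k : P \is monic -> irreducible_poly P ->
  (add_stab P = [set 0]%classic -> card_le `I_k [set: F]) ->
  (add_stab P <> [set 0]%classic -> mul_stab P = [set 1]%classic ->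
     card_le `I_k [set a : F | a != 0]) ->
  exists s : nat -> {poly F}, (forall i, Omega_conjugate P (s i)) /\
    (forall i j, (i < k)%N -> (j < k)%N -> s i = s j -> i = j).
Proof.
move=> Pm Pi cardS cardT.
have [S0|S0] := pselect (add_stab P = [set 0]%classic).
  have [s [_ s_inj]] := card_le_injection 0 (cardS S0).
  exists (fun i => Omega_act 1 (s i) P); split=> [i|i j ik jk].
    by exists 1, (s i); rewrite oner_neq0.
  move=> /(Omega_act_eq (oner_neq0 _) (oner_neq0 _)); rewrite !divr1 mul1r.
  move=> /add_stabE; rewrite S0 /= => /eqP; rewrite subr_eq0 => /eqP.
  exact: s_inj.
have [T1|T1] := pselect (mul_stab P = [set 1]%classic).
  have [s [s0 s_inj]] := card_le_injection 1 (cardT S0 T1).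
  exists (fun i => if (i < k)%N then Omega_act (s i) 0 P else P);
    split=> [i|i j ik jk].
    case: ifP => [/s0 si|_]; last exact: Omega_conj_refl.
    by exists (s i), 0.
  rewrite ik jk; have [si sj] := (s0 _ ik, s0 _ jk).
  move=> /(Omega_act_eq si sj); rewrite mul0r mulr0 subr0 => aP.
  have : mul_stab P (s i / s j) by apply/mul_stabE; rewrite mulf_neq0 ?invr_eq0.
  rewrite T1 /= => /(canRL (divfK sj)); rewrite mul1r; exact: s_inj.
have [b [b0 Pb]] : exists b, b != 0 /\ Omega_act 1 b P = P.
  apply: contrapT => nb; apply: S0; apply/seteqP; split=> [b|b ->] /=.
    move=> /add_stabE Pb; apply: contrapT => /eqP b0; apply: nb; by exists b.
  by apply/add_stabE; rewrite Omega_act10.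
have [a [a0 a1 Pa]] : exists a, [/\ a != 0, a <> 1 & Omega_act a 0 P = P].
  apply: contrapT => na; apply: T1; apply/seteqP; split=> [a|a ->] /=.
    move=> /mul_stabE[a0 Pa]; apply: contrapT => a1; apply: na; by exists a.
  by apply/mul_stabE; rewrite oner_neq0 Omega_act10.
have infF (s : seq F) : exists x, x \notin s.
  apply: contrapT => sN; apply: a1;
    apply: (stabilizers_finite_field (s := s) _ Pm Pi a0 b0 Pb Pa).
  by move=> x; apply: contrapT => xs; apply: sN; exists x; apply/negP.
have [p1 _] := Pi.
have [s [ss us]] := infinite_distinct_values k p1 infF.
exists (fun i => Omega_act 1 s`_i P); split=> [i|i j ik jk].
  by exists 1, s`_i; rewrite oner_neq0.
(* The constant term of [P(X + b)] is [P(b)]. *)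
move=> /(congr1 (fun h => h.[0])); rewrite !Omega_actE !hornerE /= => ij.
apply/eqP; rewrite -(nth_uniq 0 _ _ us) ?size_map ?ss//.
rewrite !(nth_map 0) ?ss//; apply/eqP; move: ij.
by rewrite !expr1n !invr1 !mul1r !horner_comp /aff !hornerE.
Qed.

End Orbit.

(** * Assembling the similarity *)

Section Assembly.
Variable F : fieldType.

(** All indices [i] whose [p i] lie in one class share a representative [rep
    i]; [r i] is the conjugate of [p (rep i)] whose number, in an injective
    numbering of the orbit, is the rank of [i] in its class. *)
Lemma distinct_conjugates m (p : 'I_m -> {poly F}) (e : 'I_m -> nat) :
  (forall i, [/\ p i \is monic, irreducible_poly (p i) & (0 < e i)%N]) ->
  (forall i (k := ell (fun j => p j ^+ e j) (p i)),
    (add_stab (p i) = [set 0]%classic -> card_le `I_k [set: F]) /\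
    (add_stab (p i) <> [set 0]%classic -> mul_stab (p i) = [set 1]%classic ->
       card_le `I_k [set a : F | a != 0])) ->
  exists2 r : 'I_m -> {poly F},
    forall i, Omega_conjugate (p i) (r i) & injective r.
Proof.
move=> pe card_ell.
pose cl i := [set j | `[< Omega_conjugate (p i) (p j) >]]%SET.
have clP i j : reflect (Omega_conjugate (p i) (p j)) (j \in cl i).
  by rewrite inE; apply: asboolP.
have clii i : i \in cl i by apply/clP/Omega_conj_refl.
have cl_eq i j : Omega_conjugate (p i) (p j) -> cl i = cl j.
  move=> ij; apply/setP => k; apply/clP/clP.
    by apply: Omega_conj_trans; apply: Omega_conj_sym.
  exact: Omega_conj_trans.
(* The default [i] is never used, as [i] lies in its own class. *)
pose rep i := odflt i [pick j in cl i].
have repP i : rep i \in cl i.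
  by rewrite /rep; case: pickP => //= /(_ i); rewrite clii.
have rep_eq i j : cl i = cl j -> rep i = rep j.
  by rewrite /rep => ->; case: pickP => // /(_ j); rewrite clii.
have /choice[s sP] : forall i, exists s : nat -> {poly F},
    (forall k, Omega_conjugate (p i) (s k)) /\
    forall k l, (k < #|cl i|)%N -> (l < #|cl i|)%N -> s k = s l -> k = l.
  move=> i; have [pm pi _] := pe i; have [cS cT] := card_ell i.
  have [s [s1 s2]] := orbit_injection pm pi cS cT.
  have le_cl : (#|cl i| <= ell (fun j => p j ^+ e j) (p i))%N.
    apply/subset_leq_card/fintype.subsetP => j /clP ij; rewrite unfold_in /=;
      apply/asboolP.
    by exists (p j), (e j); have [_ _ ej] := pe j.
  exists s; split=> // k l kl ll; apply: s2; exact: leq_trans le_cl.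
exists (fun i => s (rep i) (index i (enum (cl i)))) => [i|i j /= ij].
  by apply: (Omega_conj_trans _ (proj1 (sP (rep _)) _)); apply/clP.
have cij : cl i = cl j.
  have H k : Omega_conjugate (p k) (s (rep k) (index k (enum (cl k)))).
    by apply: (Omega_conj_trans _ (proj1 (sP (rep _)) _)); apply/clP.
  apply: cl_eq; apply: (Omega_conj_trans (H i)); rewrite ij.
  exact: Omega_conj_sym.
have lt k : (index k (enum (cl k)) < #|cl (rep k)|)%N.
  rewrite -(cl_eq k (rep k)); last by apply/clP.
  by rewrite cardE index_mem mem_enum.
have jcl : j \in enum (cl i) by rewrite mem_enum cij.
have icl : i \in enum (cl i) by rewrite mem_enum.
rewrite -[i](nth_index i icl) -[in RHS](nth_index i jcl); congr (nth i _ _).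
apply: (proj2 (sP (rep i))); first exact: lt.
  by rewrite (rep_eq _ _ cij) cij.
by rewrite ij -(rep_eq _ _ cij) cij.
Qed.

Lemma size_prod_pred m (f : 'I_m -> {poly F}) : (forall i, f i != 0) ->
  size (\prod_i f i) = (\sum_i (size (f i)).-1).+1.
Proof.
move=> f0; rewrite size_prod// -sum1_card subSn; last first.
  by apply: leq_sum => i _; rewrite size_poly_gt0.
rewrite (_ : \sum_i size (f i) =
  \sum_i (size (f i)).-1 + \sum_(i < m) 1)%N ?addnK//.
by rewrite -big_split /=; apply: eq_bigr => i _;
  rewrite addn1 prednK// size_poly_gt0.
Qed.

Lemma simmx_common n (A B D : 'M[F]_n) :
  A ~_{in unitmx} D -> B ~_{in unitmx} D -> A ~_{in unitmx} B.
Proof.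
move=> [P Pu /eqP PA] [Q Qu /eqP QB]; exists (invmx Q *m P).
  by rewrite unitmx_mul unitmx_inv Qu.
apply/eqP; rewrite mxpoly.conjuMumx ?unitmx_inv// PA -QB.
exact: mxpoly.conjmxK.
Qed.

Lemma similar_polynomial_companion n (A : 'M[F]_n.+1) m (p r : 'I_m -> {poly F})
    (e : 'I_m -> nat) :
  (forall i, [/\ p i \is monic & irreducible_poly (p i)]) ->
  (forall i, Omega_conjugate (p i) (r i)) -> injective r ->
  elementary_divisors A (fun i => p i ^+ e i) ->
  exists g, A ~_{in unitmx}
    horner_mx (companion n.+1 (\prod_(i < m) r i ^+ e i)) g.
Proof.
move=> pP pr r_inj [_ [eq_n simA]].
have /choice[l lE] : forall i, exists ab : F * F,
    ab.1 != 0 /\ r i = Omega_act ab.1 ab.2 (p i).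
  by move=> i; have [a [b ab]] := pr i; exists (a, b).
have rm i : r i \is monic.
  by have [pm _] := pP i; have [a0 ->] := lE i; apply: monic_Omega_act.
have ri i : irreducible_poly (r i).
  by have [_ pi] := pP i; have [a0 ->] := lE i; apply: irreducible_Omega_act.
have fm i : r i ^+ e i \is monic by apply: monic_exp.
have cop i j : i != j -> coprimep (r i ^+ e i) (r j ^+ e j).
  move=> ij; apply/coprimep_expl/coprimep_expr.
  rewrite irreducible_poly_coprime//; apply: contra ij => rij.
  have r1 : size (r i) != 1%N by have [r1 _] := ri i; rewrite neq_ltn r1 orbT.
  have := (ri j).2 _ r1 rij; rewrite eqp_monic// => /eqP.
  by move/r_inj ->.
have [g gE] := poly_chinese cop (fun i => aff (l i).1 (l i).2).
exists g; have fs : size (\prod_i r i ^+ e i) = n.+2.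
  rewrite size_prod_pred => [|i]; last exact/monic_neq0.
  rewrite -eq_n; congr S; apply: eq_bigr => i _.
  by have [a0 ->] := lE i; rewrite -Omega_actX size_Omega_act.
have [i h|u dec] :=
  decomp_companion (q := fun i => p i ^+ e i) fm fs cop (g := g).
  rewrite (dvdp_comp_congr _ (gE i)); have [a0 ->] := lE i.
  by rewrite -Omega_actX dvdp_Omega_act.
apply: simmx_common simA _; apply: decomp_similar dec => i.
by have [pm _] := pP i; apply: monic_exp.
Qed.

Lemma elementary_divisors_exist n (A : 'M[F]_n.+1) :
  exists m (p : 'I_m -> {poly F}) (e : 'I_m -> nat),
    (forall i, [/\ p i \is monic, irreducible_poly (p i),
                   p i %| mxminpoly A & (0 < e i)%N]) /\
    elementary_divisors A (fun i => p i ^+ e i).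
Proof.
have [|m [p [e [u [pe _ dec rk]]]]] :=
  @stable_primary_decomposition F n A^T 1%:M.
  by rewrite submx1.
rewrite mxrank1 in rk.
exists m, p, e; split=> [i|].
  have [pm pi ei] := pe i; split=> //.
  have /(decomp_act0 _ _ dec) : u i *m horner_mx A^T (mxminpoly A) = 0.
    by rewrite -horner_mx_tr mx_root_minpoly trmx0 mulmx0.
  by apply: dvdp_trans; rewrite -(prednK ei) exprS dvdp_mulr.
split=> [i|]; first by have [pm pi ei] := pe i; exists (p i), (e i).
exists rk; apply: decomp_similar dec => i.
by have [pm _ _] := pe i; apply: monic_exp.
Qed.

End Assembly.

Local Open Scope classical_set_scope.
Local Open Scope card_scope.

Theorem theorem3p5 (F : fieldType) (n : nat) (A : 'M[F]_n.+1)
    (card_ell : forall (m : nat) (q : 'I_m -> {poly F}),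
       elementary_divisors A q ->
       forall p : {poly F},
         p \is monic -> irreducible_poly p -> p %| mxminpoly A ->
         (add_stab p = [set 0] -> `I_(ell q p) #<= [set: F]) /\
         (add_stab p <> [set 0] -> mul_stab p = [set 1] ->
            `I_(ell q p) #<= [set a : F | a != 0])) :
  polynomial_type A /\
  forall (m : nat) (p : 'I_m -> {poly F}) (e : 'I_m -> nat),
    (forall i, [/\ p i \is monic, irreducible_poly (p i),
                   p i %| mxminpoly A & (0 < e i)%N]) ->
    elementary_divisors A (fun i => p i ^+ e i) ->
    exists (g : {poly F}) (r : 'I_m -> {poly F}),
      [/\ forall i, Omega_conjugate (p i) (r i),
          injective r
        & A ~_{in unitmx}
            horner_mx (companion n.+1 (\prod_(i < m) r i ^+ e i)) g].
Proof.
have main (m : nat) (p : 'I_m -> {poly F}) (e : 'I_m -> nat) :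
    (forall i, [/\ p i \is monic, irreducible_poly (p i),
                   p i %| mxminpoly A & (0 < e i)%N]) ->
    elementary_divisors A (fun i => p i ^+ e i) ->
    exists (g : {poly F}) (r : 'I_m -> {poly F}),
      [/\ forall i, Omega_conjugate (p i) (r i),
          injective r
        & A ~_{in unitmx}
            horner_mx (companion n.+1 (\prod_(i < m) r i ^+ e i)) g].
  move=> pe ed; have [i|i k|r rP r_inj] := @distinct_conjugates F m p e.
  - by have [? ? _ ?] := pe i.
  - by have [? ? ? ?] := pe i; apply: card_ell.
  have [i|g simA] := similar_polynomial_companion _ rP r_inj ed.
    by have [? ? _ _] := pe i.
  by exists g, r.
split=> //.
have [m [p [e [pe ed]]]] := elementary_divisors_exist A.
have [g [r [pr r_inj simA]]] := main m p e pe ed.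
have rm i : r i ^+ e i \is monic.
  have [pm _ _ _] := pe i; have [a [b [a0 ->]]] := pr i.
  exact/monic_exp/monic_Omega_act.
exists (\prod_(i < m) r i ^+ e i), g; split=> //; first exact: monic_prod.
rewrite size_prod_pred => [|i]; last exact/monic_neq0.
have [_ [eq_n _]] := ed; rewrite -eq_n; congr S; apply: eq_bigr => i _.
by have [a [b [a0 ->]]] := pr i; rewrite -Omega_actX size_Omega_act.
Qed.
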